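(* Let $\Gamma$ be an abelian group written additively, $\pi$ a $\Gamma$-quotient labeling of a finite graph $G$, and $T$ a maximal forest of $G$. Then for every oriented bond $\vec B$ of $G$, $\varphi_{\pi,T}(\vec B)=\pi(\vec B)$.
   Context: A bond is a minimal nonempty edge cut; $\delta(X)$ is the set of non-loop edges with exactly one endpoint in a vertex set $X$. An oriented bond $\vec B$ is a bond $\delta(X)$ with all edges oriented away from $X$ or all towards $X$. A $\Gamma$-gain function assigns to each oriented edge $e$ a value $\varphi(e)\in\Gamma$ with $\varphi(-e)=-\varphi(e)$ ($-e$ the reverse orientation), and $\varphi(\vec B)=\sum_{e\in\vec B}\varphi(e)$. A $\Gamma$-quotient labeling is a map $\pi:V(G)\to\Gamma$ with $\sum_{v\in V(H)}\pi(v)=0$ for each connected component $H$; write $\pi(X)=\sum_{v\in X}\pi(v)$, and for a bond $\delta(X)$ oriented towards $X$ set $\pi(\vec B)=\pi(X)$ (so the reverse orientation gets $-\pi(X)$). The gain function $\varphi_{\pi,T}$ is defined by: $\varphi_{\pi,T}(e)=0$ for edges $e\notin T$; for an edge $e\in T$, removing $e$ from $T$ splits one tree of $T$ into two trees; let $X$ be the vertex set of one of them, so that $B=\delta(X)$ is the bond of edges of $G$ joining the two trees; orient $e$ towards $X$ and set $\varphi_{\pi,T}(e)=\pi(X)$ (this is independent of the choice of side). *)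

(* Defs.v *)
From HB Require Import structures.
From mathcomp Require Import all_boot all_order all_algebra.

Set Implicit Arguments.
Unset Strict Implicit.
Unset Printing Implicit Defensive.

Import GRing.Theory.
Local Open Scope ring_scope.

(* Finite graphs; loops and multiple edges are allowed. The order of the two
   ends of an edge only serves to name its two orientations. *)
Record mgraph := MGraph {
  vertex : finType;
  edge : finType;
  src : edge -> vertex;
  dst : edge -> vertex
}.

Section Graph.
Variable G : mgraph.
Implicit Types (S T B : {set edge G}) (X : {set vertex G}).

(* [(e, true)] is [e] oriented from [src e] to [dst e], [(e, false)] is its
   reverse. A loop also has two distinct orientations. *)
Definition oedge : finType := (edge G * bool)%type.

Implicit Types (a b : oedge) (p : seq oedge).

Definition orev a : oedge := (a.1, ~~ a.2).
Definition tail a : vertex G := if a.2 then src a.1 else dst a.1.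
Definition head a : vertex G := if a.2 then dst a.1 else src a.1.

Definition adj S : rel (vertex G) :=
  [rel x y | [exists a : oedge, [&& a.1 \in S, tail a == x & head a == y]]].

(* vertex set of the connected component of [x] in the spanning subgraph with
   edge set [S] *)
Definition component S (x : vertex G) : {set vertex G} :=
  [set y | connect (adj S) x y].

(* Loops are circles of length 1 and pairs of parallel edges are circles of
   length 2; the condition on edges prevents going back and forth along one
   edge. *)
Definition circle p : bool :=
  [&& p != [::], cycle [rel a b | head a == tail b] p,
      uniq (map tail p) & uniq (map fst p)].

Definition forest T : Prop :=
  forall p, circle p -> ~~ all (fun a => a.1 \in T) p.

Definition maximal_forest T : Prop :=
  forest T /\ forall T', forest T' -> T \subset T' -> T' = T.

(* A loop is never in [delta X], as both its ends are the same vertex. *)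
Definition delta X : {set edge G} :=
  [set e | (src e \in X) (+) (dst e \in X)].

Definition bond B : bool :=
  minset (fun C : {set edge G} => (C != set0) && [exists X, C == delta X]) B.

(* Several vertex sets can define the same bond when [G] is disconnected; an
   oriented bond is presented by one of them, together with the direction. *)
Record oriented_bond := OrientedBond {
  bond_side : {set vertex G};
  bond_towards : bool;
  bond_sideP : bond (delta bond_side)
}.

Definition oedges_towards X : {set oedge} :=
  [set a | (tail a \notin X) && (head a \in X)].

Definition oedges_away X : {set oedge} :=
  [set a | (tail a \in X) && (head a \notin X)].

Definition bond_oedges (oB : oriented_bond) : {set oedge} :=
  if bond_towards oB then oedges_towards (bond_side oB)
  else oedges_away (bond_side oB).

Section Gain.
Variable Gamma : zmodType.

Record gain_function := GainFunction {
  gain_val :> oedge -> Gamma;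
  gain_orev : forall a, gain_val (orev a) = - gain_val a
}.

Definition gain_of_bond (phi : gain_function) (oB : oriented_bond) : Gamma :=
  \sum_(a in bond_oedges oB) phi a.

Definition quotient_labeling (pi : vertex G -> Gamma) : Prop :=
  forall x, \sum_(v in component [set: edge G] x) pi v = 0.

Definition label_of_set (pi : vertex G -> Gamma) X : Gamma :=
  \sum_(v in X) pi v.

Definition label_of_bond (pi : vertex G -> Gamma) (oB : oriented_bond) : Gamma :=
  if bond_towards oB then label_of_set pi (bond_side oB)
  else - label_of_set pi (bond_side oB).

Section ForestGain.
Variables (pi : vertex G -> Gamma) (T : {set edge G}).

(* Of the two trees into which removing [e] splits a tree of [T], we take the
   one containing [dst e], so that [(e, true)] is oriented towards it. For a
   quotient labeling and a maximal forest the other choice gives the same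
   values. *)
Definition forest_gain_val a : Gamma :=
  if a.1 \in T then
    let X := component (T :\ a.1) (dst a.1) in
    if a.2 then label_of_set pi X else - label_of_set pi X
  else 0.

Lemma forest_gain_orev a : forest_gain_val (orev a) = - forest_gain_val a.
Proof.
case: a => e o; rewrite /forest_gain_val /orev /=.
by case: ifP => _; [case: o; rewrite /= ?opprK | rewrite oppr0].
Qed.

Definition forest_gain : gain_function := GainFunction forest_gain_orev.

End ForestGain.
End Gain.
End Graph.

(* Main.v *)
(* Writing [d e = [dst e \in X] - [src e \in X]], the gain of the bond towards
   [X] is [\sum_w pi w * g w], where [g w] is the sum of [d e] over the edges
   [e] of [T] such that [w] lies on the side of [dst e] in [T - e]. Across an
   edge [f] of [T], the only term of [g] that changes is the one of [f], so [g]
   and the indicator of [X] have the same increment along [f]. Hence their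
   difference is constant on the components of [T], which are those of [G], and
   pairing it with the quotient labeling [pi] gives [0]. *)

Require Import Defs.
From mathcomp Require Import all_boot all_order all_algebra.
(* [seq] also exports a [head]. *)
Import Defs.

Set Implicit Arguments.
Unset Strict Implicit.
Unset Printing Implicit Defensive.

Import GRing.Theory.
Local Open Scope ring_scope.

Section Connectivity.
Variable G : mgraph.
Implicit Types (S T : {set edge G}) (x y : vertex G) (e : edge G).

Lemma adjP S x y :
  reflect (exists a : oedge G, [/\ a.1 \in S, tail a = x & head a = y])
          (adj S x y).
Proof.
apply: (iffP existsP) => -[a]; first by case/and3P => aS /eqP ? /eqP ?; exists a.
by case=> aS <- <-; exists a; rewrite aS !eqxx.
Qed.

Lemma adj_oedge S (a : oedge G) : a.1 \in S -> adj S (tail a) (head a).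
Proof. by move=> aS; apply/adjP; exists a. Qed.

Lemma adj_sym S : symmetric (adj S).
Proof.
suff sub x y : adj S x y -> adj S y x by move=> x y; apply/idP/idP; apply: sub.
case/adjP=> -[e o] [/= eS <- <-]; apply/adjP; exists (e, ~~ o).
by case: o.
Qed.

Lemma adj_connect_sym S : connect_sym (adj S).
Proof. exact/sym_connect_sym/adj_sym. Qed.

Lemma mem_component S x y : (y \in component S x) = connect (adj S) x y.
Proof. by rewrite inE. Qed.

Lemma component_eq S x y : (component S x == component S y) = connect (adj S) x y.
Proof.
apply/eqP/idP => [Exy | xy]; first by rewrite -mem_component Exy mem_component.
apply/setP=> z; rewrite !mem_component.
exact: (same_connect (adj_connect_sym S) xy).
Qed.

(** Only the edges strictly between [a] and [b] have to lie in [S]. Taking [a = b] opens a circle at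
    one of its edges. *)
Lemma oedge_path_connect S (a b : oedge G) (q : seq (oedge G)) :
  path [rel a b | head a == tail b] a (rcons q b) ->
  all (fun c => c.1 \in S) q -> connect (adj S) (head a) (tail b).
Proof.
elim: q a => [|c q IHq] a /=; first by rewrite andbT => /eqP->.
case/andP=> /eqP-> qb /andP[cS qS].
exact: connect_trans (connect1 (adj_oedge cS)) (IHq _ qb qS).
Qed.

(** Lifts a simple vertex path to oriented edges, in the form needed to close it up with [c] into a
    [circle]. The edge [c.1] may recur in [q] unless [S] excludes it. *)
Lemma oedge_walk S (c : oedge G) (p : seq (vertex G)) :
  path (adj S) (head c) p -> uniq (head c :: p) ->
  exists q : seq (oedge G),
    [/\ path [rel a b | head a == tail b] c q,
        head (last c q) = last (head c) p,
        map (@tail G) q = belast (head c) p,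
        uniq (map fst q) & all (fun a => a.1 \in S) q].
Proof.
elim: p c => [|y p IHp] c; first by exists [::].
move=> /= /andP[/adjP[a [aS ta ha]] yp] /andP[cNyp yp_uniq].
have [||q [q_path q_last q_tails q_uniq qS]] := IHp a; first by rewrite ha.
  by rewrite ha.
exists (a :: q); split; rewrite /= ?q_tails ?ta ?ha ?eqxx ?aS //.
  by rewrite q_last ha.
(* An edge of [q] has both ends in [y :: p], whereas [a] starts outside it. *)
rewrite q_uniq andbT; apply: contra cNyp => /mapP[b bq eab].
have tb : tail b \in y :: p.
  by apply: mem_belast; rewrite -ha -q_tails map_f.
have hb : head b \in y :: p.
  (* Along a walk, the heads are the tails shifted by one place, completed by the final head. *)
  have hE (d : oedge G) (s : seq (oedge G)) :
      path [rel a b | head a == tail b] d s ->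
      map (@head G) s = behead (rcons (map (@tail G) s) (head (last d s))).
    elim: s d => //= d' s IHs d /andP[_ s_path]; rewrite (IHs d') //.
    by case: s s_path {IHs} => //= d2 s /andP[/eqP-> _].
  have : head b \in map (@head G) q by rewrite map_f.
  by rewrite (hE _ _ q_path) => /mem_behead; rewrite q_last q_tails -lastI ha.
move: tb hb; rewrite -ta /tail /head -eab.
by case: (a.2); case: (b.2).
Qed.

(** A simple path from [dst e] to [src e] in [T :\ e], preceded by [e], would be a circle in [T]. If
    [e] is a loop, the path is empty and the circle is [e] alone. *)
Lemma forest_edge_bridge T e :
  forest T -> e \in T -> ~~ connect (adj (T :\ e)) (dst e) (src e).
Proof.
move=> fT eT; apply/negP=> /connectP[p0 p0_path].
case/shortenP: p0_path => p p_path p_uniq _ p_last.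
have [q [q_path q_last q_tails q_uniq qT]] :=
  @oedge_walk _ (e, true) p p_path p_uniq.
have /fT/negP[] : circle ((e, true) :: q).
  apply/and4P; split=> //.
  - by rewrite /= rcons_path q_path /= q_last -p_last.
  (* The tails are [src e] followed by the path without its last vertex, which is [src e]: a
     rotation of the simple path. *)
  - by rewrite [map _ _]/= q_tails -[tail _]/(src e) p_last /= -rcons_uniq -lastI.
  - rewrite /= q_uniq andbT; apply/mapP=> -[b /(allP qT) bT /= eb].
    by move: bT; rewrite -eb !inE eqxx.
rewrite /= eT; apply: sub_all qT => b.
by rewrite !inE => /andP[].
Qed.

(** If [T] did not join the ends of [e], then [e |: T] would still be a forest, against maximality:
    a circle through [e] uses it only once, so the rest of the circle would join these ends inside
    [T]. *)
Lemma maximal_forest_connect T e :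
  maximal_forest T -> connect (adj T) (src e) (dst e).
Proof.
case=> fT maxT; apply/negPn/negP => Nconn.
have eNT : e \notin T.
  apply: contra Nconn => eT; exact/connect1/(@adj_oedge _ (e, true)).
case/negP: eNT; rewrite -(maxT (e |: T)) ?setU11 ?subsetUr //.
move=> p p_circ; apply/negP=> pT.
have [/mapP[a ap ea] | eNp] := boolP (e \in map fst p); last first.
  case/negP: (fT p p_circ); apply/allP=> a ap.
  have := allP pT a ap; rewrite !inE => /orP[/eqP ea|//].
  by case/negP: eNp; rewrite -ea map_f.
have [i q Epq] := rot_to ap.
case/and4P: p_circ => _ p_cycle _ p_uniq.
have q_path : path [rel a b | head a == tail b] a (rcons q a).
  by move: p_cycle; rewrite -(rot_cycle i) Epq.
have eNq : e \notin map fst q.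
  by move: p_uniq; rewrite -(rot_uniq i) -map_rot Epq /= -ea => /andP[].
have qT : all (fun c => c.1 \in T) q.
  apply/allP=> b bq; have /(allP pT) : b \in p.
    by rewrite -(mem_rot i) Epq inE bq orbT.
  rewrite !inE => /orP[/eqP eb|//].
  by case/negP: eNq; rewrite -eb map_f.
case/negP: Nconn; move: (oedge_path_connect q_path qT); rewrite /head /tail -ea.
by case: (a.2); rewrite // adj_connect_sym.
Qed.

Lemma connect_const S (A : Type) (h : vertex G -> A) :
  (forall e, e \in S -> h (src e) = h (dst e)) ->
  forall x y, connect (adj S) x y -> h x = h y.
Proof.
move=> hS x y /connectP[p]; elim: p x => [|z p IHp] x /=; first by move=> _ ->.
case/andP=> /adjP[[e o] [/= /hS he <- <-]] zp /(IHp _ zp) <-.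
by case: o {zp}; rewrite /tail /head /=.
Qed.

End Connectivity.

Section Gain.
Variables (Gamma : zmodType) (G : mgraph).
Implicit Types (X : {set vertex G}) (pi : vertex G -> Gamma).

(** Integer-valued, so that it acts on any [Gamma] through [*~]. *)
Definition coboundary X (e : edge G) : int := (dst e \in X)%:Z - (src e \in X)%:Z.

Lemma sum_oedges_towards (phi : gain_function G Gamma) X :
  \sum_(a in oedges_towards X) phi a
  = \sum_e phi (e, true) *~ coboundary X e.
Proof.
rewrite big_mkcond /= (eq_bigr (fun a : oedge G =>
  if (a.1, a.2) \in oedges_towards X then phi (a.1, a.2) else 0)); last by case.
rewrite -(pair_big xpredT xpredT (fun e b =>
  if (e, b) \in oedges_towards X then phi (e, b) else 0)) /=.
apply: eq_bigr => e _; rewrite big_bool /coboundary !inE /tail /head /=.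
have -> : phi (e, false) = - phi (e, true) by rewrite -gain_orev.
by case: (src e \in X); case: (dst e \in X);
  rewrite /= ?subrr ?subr0 ?sub0r ?mulrNz ?mulr1z ?mulr0z ?addr0 ?add0r.
Qed.

Lemma oedges_awayE X : oedges_away X = oedges_towards (~: X).
Proof. by apply/setP=> a; rewrite !inE negbK. Qed.

Lemma coboundaryC X e : coboundary (~: X) e = - coboundary X e.
Proof. by rewrite /coboundary !inE; case: (dst e \in X); case: (src e \in X). Qed.

Lemma quotient_labeling_const pi (h : vertex G -> int) :
  quotient_labeling pi -> (forall e, h (src e) = h (dst e)) ->
  \sum_v pi v *~ h v = 0.
Proof.
move=> hpi hE; rewrite (partition_big (component [set: edge G]) xpredT) //=.
apply: big1 => C _.
have [/existsP[x /eqP xC] | NC] :=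
  boolP [exists x, component [set: edge G] x == C]; last first.
  (* A set [C] that is not a component indexes an empty sum. *)
  by apply: big1 => v vC; case/negP: NC; apply/existsP; exists v.
transitivity ((\sum_(v in component [set: edge G] x) pi v) *~ h x); last first.
  by rewrite hpi mul0rz.
rewrite -xC mulrz_suml.
apply: eq_big => v; rewrite component_eq adj_connect_sym.
  by rewrite mem_component.
by move=> xv; rewrite (connect_const (fun e _ => hE e) xv).
Qed.

Lemma forest_gain_towards pi (T : {set edge G}) X :
  quotient_labeling pi -> maximal_forest T ->
  \sum_(a in oedges_towards X) forest_gain pi T a = label_of_set pi X.
Proof.
move=> hpi hT; rewrite sum_oedges_towards.
pose g w : int := \sum_(e in T)
  (w \in component (T :\ e) (dst e))%:Z * coboundary X e.
have gE : \sum_e forest_gain pi T (e, true) *~ coboundary X e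
          = \sum_w pi w *~ g w.
  transitivity (\sum_(e in T) \sum_w
      pi w *~ ((w \in component (T :\ e) (dst e))%:Z * coboundary X e)).
    rewrite [RHS]big_mkcond; apply: eq_bigr => e _ /=.
    rewrite /forest_gain_val /=; case: ifP => _; last by rewrite mul0rz.
    rewrite /label_of_set big_mkcond mulrz_suml; apply: eq_bigr => w _.
    by case: ifP; rewrite ?mul1r ?mul0r ?mul0rz ?mulr0z.
  by rewrite exchange_big; apply: eq_bigr => w _; rewrite mulrz_sumr.
have gT f : f \in T -> g (dst f) - g (src f) = coboundary X f.
  move=> fT; rewrite /g -sumrB (bigD1 f) //= big1 => [|e /andP[eT ef]].
    rewrite !mem_component connect0 (negPf (forest_edge_bridge hT.1 fT)).
    by rewrite mul1r mul0r subr0 addr0.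
  rewrite !mem_component.
  (* For [e] other than [f], the edge [f] survives in [T :\ e], so its ends lie on the same side and
     the term of [e] cancels. *)
  have /connect1 sf : adj (T :\ e) (src f) (dst f).
    by apply: (@adj_oedge _ _ (f, true)); rewrite !inE eq_sym ef.
  by rewrite (same_connect_r (adj_connect_sym _) sf) subrr.
pose h w : int := g w - (w \in X)%:Z.
have hE e : h (src e) = h (dst e).
  (* The increments are known on [T] only; an arbitrary [e] is replaced by a path of [T] between its
     ends. *)
  apply: connect_const (maximal_forest_connect e hT) => f fT.
  have /eqP := gT f fT; rewrite /h /coboundary subr_eq => /eqP ->.
  by rewrite [RHS]addrAC [_ - _ - _]addrAC subrr sub0r addrC.
rewrite gE /label_of_set [RHS]big_mkcond; apply: subr0_eq; rewrite -sumrB.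
rewrite -[RHS](quotient_labeling_const hpi hE); apply: eq_bigr => w _.
by rewrite /h mulrzBr; case: (w \in X); rewrite ?mulr1z ?mulr0z.
Qed.

End Gain.

Theorem theorem4p6 (Gamma : zmodType) (G : mgraph) (pi : vertex G -> Gamma)
    (T : {set edge G}) (hpi : quotient_labeling pi) (hT : maximal_forest T)
    (oB : oriented_bond G) :
  gain_of_bond (forest_gain pi T) oB = label_of_bond pi oB.
Proof.
rewrite /gain_of_bond /label_of_bond /bond_oedges; case: ifP => _.
  exact: forest_gain_towards.
(* Away from a side means towards its complement, which only changes the sign of the coboundary. *)
rewrite oedges_awayE -(forest_gain_towards _ hpi hT) !sum_oedges_towards -sumrN.
by apply: eq_bigr => e _; rewrite coboundaryC mulrNz.
Qed.
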